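(* Let $(\mathbb G,\nu)$ be a totally disconnected groupoid with object set $\mathbb N$ and a monoidal structure $\nu$ that is multiplicative on objects. For every $\mathbb G$-sequence $\mathcal Y$, the functor $-\square\,\mathcal Y:\mathbb G\mathsf{Seq}\to\mathbb G\mathsf{Seq}$ is left adjoint to the functor $\mathrm{Map}_{\mathbb G}\big(\mathcal Y,\gamma^{\mathbb G}_\bullet(-)\big):\mathbb G\mathsf{Seq}\to\mathbb G\mathsf{Seq}$, and this adjunction is natural in $\mathcal Y$.
   Context: $\mathbb G$ is a totally disconnected groupoid with set of objects $\mathbb N=\{0,1,2,\dots\}$; $G_n=\mathbb G(n,n)$, with neutral element $e_n$. The monoidal structure $\nu:\mathbb G\times\mathbb G\to\mathbb G$ satisfies $\nu(m,n)=mn$ on objects, so it provides homomorphisms $\nu_{m,n}:G_m\times G_n\to G_{mn}$ with $\nu_{lm,n}(\nu_{l,m}\times\mathrm{id})=\nu_{l,mn}(\mathrm{id}\times\nu_{m,n})$ for all $l,m,n$. $\mathbb G\mathsf{Seq}$ is the category of $\mathbb G$-sequences, i.e. of functors $\mathbb G^{op}\to\mathsf S$ ($\mathsf S$ = simplicial sets); its objects are sequences $\mathcal X=(\mathcal X(n))_{n\ge0}$ of simplicial sets with actions $\mathcal X(n)\times G_n\to\mathcal X(n)$. The matrix monoidal product is $(\mathcal X\square\mathcal Y)(n)=\coprod_{lm=n}\big(\mathcal X(l)\times\mathcal Y(m)\big)\times_{G_l\times G_m}G_n$, with $G_l\times G_m$ acting on $G_n$ via $\nu_{l,m}$. $\mathrm{map}_{G}$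 denotes the simplicial mapping space of equivariant maps between simplicial $G$-sets, and $\mathrm{Map}_{\mathbb G}(\mathcal X,\mathcal Y)=\prod_n\mathrm{map}_{G_n}(\mathcal X(n),\mathcal Y(n))$. Divided powers: for $\mathcal X\in\mathbb G\mathsf{Seq}$ and $n\ge0$, $\gamma^{\mathbb G}_n(\mathcal X)$ is the $\mathbb G$-sequence with $\gamma^{\mathbb G}_n(\mathcal X)(m)=\nu_{m,n}^*\mathcal X(mn)$, i.e. the $G_{mn}$-action on $\mathcal X(mn)$ is pulled back along $\nu_{m,n}$ to an action of $G_m\times G_n$, and then to an action of $G_m$ (through $a\mapsto\nu_{m,n}(a,e_n)$). For all $m$, $\gamma^{\mathbb G}_n(\mathcal X)(m)$ also carries a natural commuting $G_n$-action (through $b\mapsto\nu_{m,n}(e_m,b)$). The graded divided powers functor is $\gamma^{\mathbb G}_\bullet(\mathcal X)=(\gamma^{\mathbb G}_n(\mathcal X))_{n\ge0}$. By means of the $G_n$-actions on the $\gamma^{\mathbb G}_n(\mathcal Z)$, the sequence $\mathrm{Map}_{\mathbb G}\big(\mathcal Y,\gamma^{\mathbb G}_\bullet(\mathcal Z)\big)=\big(\mathrm{Map}_{\mathbb G}(\mathcal Y,\gamma^{\mathbb G}_n(\mathcal Z))\big)_{n\ge0}$ of simplicial sets is itself a $\mathbb G$-sequence.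
   Formalization: The divided powers are taken as γ_n(X)(m) = ν_{n,m}^*X(nm), with G_m acting through ν_{n,m}(e_n,a) and G_n through ν_{n,m}(b,e_m), instead of ν_{m,n}^*X(mn); with the original index order the adjunction fails for non-symmetric ν. *)

(* Defs.v *)
Set Warnings "-notation-overridden,-redundant-canonical-projection".
From HB Require Import structures.
From mathcomp Require Import all_boot all_order.
From mathcomp Require Import boolp classical_sets.

Set Implicit Arguments.
Unset Strict Implicit.
Unset Printing Implicit Defensive.

Import Order.Theory.

Local Open Scope group_scope.
Local Open Scope classical_set_scope.

Record category := Category {
  obj :> Type;
  hom : obj -> obj -> Type;
  idm : forall A, hom A A;
  compm : forall A B C, hom B C -> hom A B -> hom A C;
  comp1m : forall A B (f : hom A B), compm (idm B) f = f;
  compm1 : forall A B (f : hom A B), compm f (idm A) = f;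
  compmA : forall A B C D (f : hom C D) (g : hom B C) (h : hom A B),
    compm f (compm g h) = compm (compm f g) h }.

Arguments hom {_} A B.
Arguments idm {_} A.
Arguments compm {_ A B C} f g.

Record functor (C D : category) := Functor {
  fobj :> C -> D;
  fhom : forall A B : C, hom A B -> hom (fobj A) (fobj B);
  fhom_id : forall A, fhom (idm A) = idm (fobj A);
  fhom_comp : forall A B E (f : hom B E) (g : hom A B),
    fhom (compm f g) = compm (fhom f) (fhom g) }.

Arguments fhom {C D} _ {A B} _.

Record adjunction (C D : category) (F : functor C D) (U : functor D C) :=
  Adjunction {
  transpose :> forall (X : C) (Z : D), hom (F X) Z -> hom X (U Z);
  transpose_bij : forall X Z, bijective (@transpose X Z);
  transpose_natl : forall (X X' : C) (Z : D) (u : hom X' X) (f : hom (F X) Z),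
    transpose (compm f (fhom F u)) = compm (transpose f) u;
  transpose_natr : forall (X : C) (Z Z' : D) (v : hom Z Z') (f : hom (F X) Z),
    transpose (compm v f) = compm (fhom U v) (transpose f) }.

Notation "''Delta' ( j , k )" := {omorphism 'I_j.+1 -> 'I_k.+1}
  (at level 8, format "''Delta' ( j ,  k )") : type_scope.

Lemma omorphism_eq d (T : porderType d) d' (T' : porderType d')
  (f g : {omorphism T -> T'}) : f =1 g -> f = g.
Proof.
case: f g => [f [[hf]]] [g [[hg]]] /= fg.
have {}fg : f = g by apply/funext.
by subst g; rewrite (Prop_irrelevance hf hg).
Qed.

Record sset := SSet {
  simplex :> nat -> Type;
  sop : forall j k, 'Delta(j, k) -> simplex k -> simplex j;
  sop_id : forall k (x : simplex k), sop (idfun : 'Delta(k, k)) x = x;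
  sop_comp : forall i j k (t : 'Delta(j, k)) (s : 'Delta(i, j)) (x : simplex k),
    sop (t \o s : 'Delta(i, k)) x = sop s (sop t x) }.

Arguments sop {_ j k} _ _.

Record smap (X Y : sset) := SMap {
  smap_fun :> forall k, X k -> Y k;
  smap_sop : forall j k (t : 'Delta(j, k)) (x : X k),
    smap_fun (sop t x) = sop t (smap_fun x) }.

Record gsset (G : groupType) := GSSet {
  gsset_sset :> sset;
  gact : forall k, gsset_sset k -> G -> gsset_sset k;
  gact1 : forall k (x : gsset_sset k), gact x 1 = x;
  gactM : forall k (x : gsset_sset k) a b, gact x (a * b) = gact (gact x a) b;
  gact_sop : forall j k (t : 'Delta(j, k)) (x : gsset_sset k) a,
    gact (sop t x) a = sop t (gact x a) }.

Arguments gact {G _ k} _ _.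

Record gmap (G : groupType) (X Y : gsset G) := GMap {
  gmap_smap :> smap X Y;
  gmap_gact : forall k (x : X k) a, gmap_smap k (gact x a) = gact (gmap_smap k x) a }.

Lemma smap_eq (X Y : sset) (f g : smap X Y) :
  (forall k (x : X k), f k x = g k x) -> f = g.
Proof.
case: f g => [f hf] [g hg] /= fg.
have {}fg : f = g by apply/functional_extensionality_dep => k; apply/funext.
by subst g; rewrite (Prop_irrelevance hf hg).
Qed.

Lemma gmap_eq (G : groupType) (X Y : gsset G) (f g : gmap X Y) :
  (forall k (x : X k), f k x = g k x) -> f = g.
Proof.
case: f g => [f hf] [g hg] /= /smap_eq fg.
by subst g; rewrite (Prop_irrelevance hf hg).
Qed.

Definition smap_id (X : sset) : smap X X :=
  @SMap X X (fun=> id) (fun _ _ _ _ => erefl).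

Lemma smap_comp_sop (X Y Z : sset) (f : smap Y Z) (g : smap X Y)
  j k (t : 'Delta(j, k)) (x : X k) : f j (g j (sop t x)) = sop t (f k (g k x)).
Proof. by rewrite !smap_sop. Qed.

Definition smap_comp (X Y Z : sset) (f : smap Y Z) (g : smap X Y) : smap X Z :=
  SMap (smap_comp_sop f g).

Section GMap.
Variable G : groupType.
Implicit Types X Y Z : gsset G.

Definition gmap_id X : gmap X X :=
  @GMap G X X (smap_id X) (fun _ _ _ => erefl).

Lemma gmap_comp_gact X Y Z (f : gmap Y Z) (g : gmap X Y) k (x : X k) a :
  smap_comp f g k (gact x a) = gact (smap_comp f g k x) a.
Proof. by rewrite /= !gmap_gact. Qed.

Definition gmap_comp X Y Z (f : gmap Y Z) (g : gmap X Y) : gmap X Z :=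
  GMap (gmap_comp_gact f g).

End GMap.

Section Pullback.
Variables (H G : groupType) (f : UMagmaMorphism.type H G).

Section Obj.
Variable X : gsset G.

Lemma gpull1 k (x : X k) : gact x (f 1) = x.
Proof. by rewrite gmulf1 gact1. Qed.

Lemma gpullM k (x : X k) a b : gact x (f (a * b)) = gact (gact x (f a)) (f b).
Proof. by rewrite gmulfM gactM. Qed.

Lemma gpull_sop j k (t : 'Delta(j, k)) (x : X k) a :
  gact (sop t x) (f a) = sop t (gact x (f a)).
Proof. exact: gact_sop. Qed.

Definition gpull : gsset H := GSSet gpull1 gpullM gpull_sop.
End Obj.

Definition gpull_map (X Y : gsset G) (u : gmap X Y) : gmap (gpull X) (gpull Y) :=
  @GMap H (gpull X) (gpull Y) u (fun k x a => gmap_gact u x (f a)).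

End Pullback.

Section ExtProd.
Variables G H : groupType.

Section Obj.
Variables (X : gsset G) (Y : gsset H).

Definition extprod_sop j k (t : 'Delta(j, k)) (p : X k * Y k) : X j * Y j :=
  (sop t p.1, sop t p.2).

Lemma extprod_sop_id k (p : X k * Y k) :
  extprod_sop (idfun : 'Delta(k, k)) p = p.
Proof. by case: p => x y; rewrite /extprod_sop !sop_id. Qed.

Lemma extprod_sop_comp i j k (t : 'Delta(j, k)) (s : 'Delta(i, j)) (p : X k * Y k) :
  extprod_sop (t \o s : 'Delta(i, k)) p = extprod_sop s (extprod_sop t p).
Proof. by rewrite /extprod_sop !sop_comp. Qed.

Definition extprod_sset : sset := SSet extprod_sop_id extprod_sop_comp.

Definition extprod_act k (p : extprod_sset k) (c : G * H) : extprod_sset k :=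
  (gact p.1 c.1, gact p.2 c.2).

Lemma extprod_act1 k (p : extprod_sset k) : extprod_act p 1 = p.
Proof. by case: p => x y; rewrite /extprod_act !gact1. Qed.

Lemma extprod_actM k (p : extprod_sset k) a b :
  extprod_act p (a * b) = extprod_act (extprod_act p a) b.
Proof. by rewrite /extprod_act !gactM. Qed.

Lemma extprod_act_sop j k (t : 'Delta(j, k)) (p : extprod_sset k) a :
  extprod_act (sop t p) a = sop t (extprod_act p a).
Proof. by rewrite /extprod_act /= !gact_sop. Qed.

Definition extprod : gsset (G * H)%type :=
  GSSet extprod_act1 extprod_actM extprod_act_sop.
End Obj.

Section Map.
Variables (X X' : gsset G) (Y Y' : gsset H) (u : gmap X X') (v : gmap Y Y').

Definition extprod_fun k (p : extprod X Y k) : extprod X' Y' k :=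
  (u k p.1, v k p.2).

Lemma extprod_fun_sop j k (t : 'Delta(j, k)) (p : extprod X Y k) :
  extprod_fun (sop t p) = sop t (extprod_fun p).
Proof. by rewrite /extprod_fun /= !smap_sop. Qed.

Lemma extprod_fun_gact k (p : extprod X Y k) a :
  SMap extprod_fun_sop k (gact p a) = gact (SMap extprod_fun_sop k p) a.
Proof. by rewrite /= /extprod_fun /= !gmap_gact. Qed.

Definition extprod_map : gmap (extprod X Y) (extprod X' Y') :=
  GMap extprod_fun_gact.
End Map.

End ExtProd.

Section Coproduct.
Variables (G : groupType) (I : Type).

Section Obj.
Variable X : I -> gsset G.

Definition coprod_sop j k (t : 'Delta(j, k)) (p : {i : I & X i k}) : {i : I & X i j} :=
  existT (fun i => X i j) (tag p) (sop t (tagged p)).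

Lemma coprod_sop_id k (p : {i : I & X i k}) :
  coprod_sop (idfun : 'Delta(k, k)) p = p.
Proof. by case: p => i x; rewrite /coprod_sop sop_id. Qed.

Lemma coprod_sop_comp i j k (t : 'Delta(j, k)) (s : 'Delta(i, j))
  (p : {i : I & X i k}) :
  coprod_sop (t \o s : 'Delta(i, k)) p = coprod_sop s (coprod_sop t p).
Proof. by rewrite /coprod_sop sop_comp. Qed.

Definition coprod_sset : sset := SSet coprod_sop_id coprod_sop_comp.

Definition coprod_act k (p : coprod_sset k) (a : G) : coprod_sset k :=
  existT (fun i => X i k) (tag p) (gact (tagged p) a).

Lemma coprod_act1 k (p : coprod_sset k) : coprod_act p 1 = p.
Proof. by case: p => i x; rewrite /coprod_act gact1. Qed.

Lemma coprod_actM k (p : coprod_sset k) a b :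
  coprod_act p (a * b) = coprod_act (coprod_act p a) b.
Proof. by rewrite /coprod_act gactM. Qed.

Lemma coprod_act_sop j k (t : 'Delta(j, k)) (p : coprod_sset k) a :
  coprod_act (sop t p) a = sop t (coprod_act p a).
Proof. by rewrite /coprod_act /= gact_sop. Qed.

Definition coprod : gsset G := GSSet coprod_act1 coprod_actM coprod_act_sop.
End Obj.

Section Map.
Variables (X Y : I -> gsset G) (u : forall i, gmap (X i) (Y i)).

Definition coprod_fun k (p : coprod X k) : coprod Y k :=
  existT (fun i => Y i k) (tag p) (u (tag p) k (tagged p)).

Lemma coprod_fun_sop j k (t : 'Delta(j, k)) (p : coprod X k) :
  coprod_fun (sop t p) = sop t (coprod_fun p).
Proof. by rewrite /coprod_fun /= smap_sop. Qed.

Lemma coprod_fun_gact k (p : coprod X k) a :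
  SMap coprod_fun_sop k (gact p a) = gact (SMap coprod_fun_sop k p) a.
Proof. by rewrite /= /coprod_fun /= gmap_gact. Qed.

Definition coprod_map : gmap (coprod X) (coprod Y) := GMap coprod_fun_gact.
End Map.

End Coproduct.

(** The quotient of [T] by an equivalence relation [R], as the type of classes
    [R x].  [quot_map] takes direct images of classes; [fR] says that these are
    again classes. *)
Section Quotient.

Definition quot (T : Type) (R : T -> set T) := {A : set T | exists x, A = R x}.

Definition qclass (T : Type) (R : T -> set T) (x : T) : quot R :=
  exist _ (R x) (ex_intro _ x erefl).

Lemma quot_eq (T : Type) (R : T -> set T) (p q : quot R) :
  sval p = sval q -> p = q.
Proof.
by case: p q => [A hA] [B hB] /= AB; subst B; rewrite (Prop_irrelevance hA hB).
Qed.

Lemma qclassP (T : Type) (R : T -> set T) (p : quot R) : exists x, p = qclass R x.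
Proof. by case: p => A [x Ax]; exists x; apply: quot_eq. Qed.

Variables (T T' : Type) (R : T -> set T) (R' : T' -> set T') (f : T -> T').
Hypothesis fR : forall x, f @` R x = R' (f x).

Lemma quot_map_subproof (p : quot R) : exists y, f @` (sval p) = R' y.
Proof. by case: p => A [x Ax] /=; exists (f x); rewrite Ax fR. Qed.

Definition quot_map (p : quot R) : quot R' :=
  exist _ (f @` (sval p)) (quot_map_subproof p).

Lemma quot_mapE x : quot_map (qclass R x) = qclass R' (f x).
Proof. by apply: quot_eq; rewrite /= fR. Qed.

End Quotient.

(** [induced f X] is the balanced product of [X] with [G] over [H]: the quotient
    of [X * G] identifying [(x, f h * g)] with [(gact x h, g)].  [balanced] is
    already an equivalence relation, since [H] is a group. *)
Section Balanced.
Variables (H G : groupType) (f : UMagmaMorphism.type H G).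

Definition balanced (X : gsset H) k (p : X k * G) : set (X k * G) :=
  [set q | exists h, q.1 = gact p.1 h /\ p.2 = f h * q.2].

Lemma balancedP (X : gsset H) k (x : X k) (h : H) (g : G) :
  balanced (x, f h * g) = balanced (gact x h, g).
Proof.
apply/seteqP; split => -[y c] [h' /= [-> E]].
  exists (h^-1 * h') => /=; rewrite gmulfM gmulfV -mulgA -E mulKg; split => //.
  by rewrite -gactM mulVKg.
by exists (h * h') => /=; rewrite gactM gmulfM E mulgA.
Qed.

Lemma balanced_refl (X : gsset H) k (p : X k * G) : balanced p p.
Proof. by exists 1; rewrite gact1 gmulf1 mul1g. Qed.

Lemma balanced_eq (X : gsset H) k (p q : X k * G) :
  balanced p q -> balanced p = balanced q.
Proof. by case: p q => [x g] [y c] [h /= [-> ->]]; rewrite balancedP. Qed.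

Lemma balanced_image (X Y : gsset H) j k (u : X k -> Y j) (v : G -> G)
  (uH : forall x h, u (gact x h) = gact (u x) h)
  (vG : forall a b, v (a * b) = a * v b) (p : X k * G) :
  (fun q => (u q.1, v q.2)) @` balanced p = balanced (u p.1, v p.2).
Proof.
apply/seteqP; split => [_ [[x g] [h /= [-> E]] <-]|[y c] [h /= [-> E]]].
  by exists h; rewrite /= E.
exists (gact p.1 h, (f h)^-1 * p.2) => /=.
  by exists h; rewrite /= mulVKg.
by rewrite uH vG E mulKg.
Qed.

Section Obj.
Variable X : gsset H.

Definition induced_simplex k := quot (@balanced X k).

Definition induced_sop j k (t : 'Delta(j, k)) :
  induced_simplex k -> induced_simplex j :=
  quot_map (balanced_image (v := id) (fun x h => esym (gact_sop t x h)) (fun _ _ => erefl)).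

Lemma induced_sopE j k (t : 'Delta(j, k)) (x : X k) g :
  induced_sop t (qclass _ (x, g)) = qclass _ (sop t x, g).
Proof. exact: quot_mapE. Qed.

Lemma induced_sop_id k (p : induced_simplex k) :
  induced_sop (idfun : 'Delta(k, k)) p = p.
Proof. by have [[x g] ->] := qclassP p; rewrite induced_sopE sop_id. Qed.

Lemma induced_sop_comp i j k (t : 'Delta(j, k)) (s : 'Delta(i, j))
  (p : induced_simplex k) :
  induced_sop (t \o s : 'Delta(i, k)) p = induced_sop s (induced_sop t p).
Proof. by have [[x g] ->] := qclassP p; rewrite !induced_sopE sop_comp. Qed.

Definition induced_sset : sset := SSet induced_sop_id induced_sop_comp.

Definition induced_act k (p : induced_sset k) (a : G) : induced_sset k :=
  quot_map (balanced_image (v := fun g => g * a)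
    (fun (x : X k) h => erefl (gact x h)) (fun b c => esym (mulgA b c a))) p.

Lemma induced_actE k (x : X k) g a :
  induced_act (qclass _ (x, g)) a = qclass _ (x, g * a).
Proof. exact: quot_mapE. Qed.

Lemma induced_act1 k (p : induced_sset k) : induced_act p 1 = p.
Proof. by have [[x g] ->] := qclassP p; rewrite induced_actE mulg1. Qed.

Lemma induced_actM k (p : induced_sset k) a b :
  induced_act p (a * b) = induced_act (induced_act p a) b.
Proof. by have [[x g] ->] := qclassP p; rewrite !induced_actE mulgA. Qed.

Lemma induced_act_sop j k (t : 'Delta(j, k)) (p : induced_sset k) a :
  induced_act (sop t p) a = sop t (induced_act p a).
Proof.
have [[x g] ->] := qclassP p.
by rewrite /sop /= !(induced_sopE, induced_actE).
Qed.

Definition induced : gsset G :=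
  GSSet induced_act1 induced_actM induced_act_sop.
End Obj.

Section Map.
Variables (X Y : gsset H) (u : gmap X Y).

Definition induced_fun k (p : induced X k) : induced Y k :=
  quot_map (balanced_image (v := id) (fun x h => gmap_gact u x h) (fun _ _ => erefl)) p.

Lemma induced_funE k (x : X k) g :
  induced_fun (qclass _ (x, g)) = qclass _ (u k x, g).
Proof. exact: quot_mapE. Qed.

Lemma induced_fun_sop j k (t : 'Delta(j, k)) (p : induced X k) :
  induced_fun (sop t p) = sop t (induced_fun p).
Proof.
have [[x g] ->] := qclassP p.
by rewrite /sop /= !(induced_sopE, induced_funE) smap_sop.
Qed.

Lemma induced_fun_gact k (p : induced X k) a :
  SMap induced_fun_sop k (gact p a) = gact (SMap induced_fun_sop k p) a.
Proof.
have [[x g] ->] := qclassP p.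
by rewrite /gact /= !(induced_actE, induced_funE).
Qed.

Definition induced_map : gmap (induced X) (induced Y) := GMap induced_fun_gact.
End Map.

End Balanced.

Section StdSimplex.

Definition std_sop n j k (t : 'Delta(j, k)) (s : 'Delta(k, n)) : 'Delta(j, n) :=
  s \o t.

Lemma std_sop_id n k (s : 'Delta(k, n)) : std_sop (idfun : 'Delta(k, k)) s = s.
Proof. exact: omorphism_eq. Qed.

Lemma std_sop_comp n i j k (t : 'Delta(j, k)) (s : 'Delta(i, j))
  (r : 'Delta(k, n)) :
  std_sop (t \o s : 'Delta(i, k)) r = std_sop s (std_sop t r).
Proof. exact: omorphism_eq. Qed.

Definition std_simplex n : sset := SSet (@std_sop_id n) (@std_sop_comp n).

End StdSimplex.

Section MapG.
Variable G : groupType.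

Section Cylinder.
Variables (X : gsset G) (n : nat).

Definition cyl_sop j k (t : 'Delta(j, k)) (p : X k * std_simplex n k) :
  X j * std_simplex n j := (sop t p.1, sop t p.2).

Lemma cyl_sop_id k (p : X k * std_simplex n k) :
  cyl_sop (idfun : 'Delta(k, k)) p = p.
Proof. by case: p => x s; rewrite /cyl_sop !sop_id. Qed.

Lemma cyl_sop_comp i j k (t : 'Delta(j, k)) (s : 'Delta(i, j))
  (p : X k * std_simplex n k) :
  cyl_sop (t \o s : 'Delta(i, k)) p = cyl_sop s (cyl_sop t p).
Proof. by rewrite /cyl_sop !sop_comp. Qed.

Definition cyl_sset : sset := SSet cyl_sop_id cyl_sop_comp.

Definition cyl_act k (p : cyl_sset k) (a : G) : cyl_sset k := (gact p.1 a, p.2).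

Lemma cyl_act1 k (p : cyl_sset k) : cyl_act p 1 = p.
Proof. by case: p => x s; rewrite /cyl_act gact1. Qed.

Lemma cyl_actM k (p : cyl_sset k) a b :
  cyl_act p (a * b) = cyl_act (cyl_act p a) b.
Proof. by rewrite /cyl_act gactM. Qed.

Lemma cyl_act_sop j k (t : 'Delta(j, k)) (p : cyl_sset k) a :
  cyl_act (sop t p) a = sop t (cyl_act p a).
Proof. by rewrite /cyl_act /= gact_sop. Qed.

Definition cyl : gsset G := GSSet cyl_act1 cyl_actM cyl_act_sop.
End Cylinder.

Section CylinderMap.
Variables (X Y : gsset G) (u : gmap X Y) (m n : nat) (r : 'Delta(m, n)).

Definition cyl_fun k (p : cyl X m k) : cyl Y n k :=
  (u k p.1, r \o (p.2 : 'Delta(k, m)) : 'Delta(k, n)).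

Lemma cyl_fun_sop j k (t : 'Delta(j, k)) (p : cyl X m k) :
  cyl_fun (sop t p) = sop t (cyl_fun p).
Proof.
by rewrite /cyl_fun /= smap_sop; congr pair; apply: omorphism_eq.
Qed.

Lemma cyl_fun_gact k (p : cyl X m k) a :
  SMap cyl_fun_sop k (gact p a) = gact (SMap cyl_fun_sop k p) a.
Proof. by rewrite /= /cyl_fun /= gmap_gact. Qed.

Definition cyl_map : gmap (cyl X m) (cyl Y n) := GMap cyl_fun_gact.
End CylinderMap.

Section Obj.
Variables X Y : gsset G.

Definition mapG_sop j k (t : 'Delta(j, k)) (f : gmap (cyl X k) Y) :
  gmap (cyl X j) Y := gmap_comp f (cyl_map (gmap_id X) t).

Lemma mapG_sop_id k (f : gmap (cyl X k) Y) :
  mapG_sop (idfun : 'Delta(k, k)) f = f.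
Proof.
apply: gmap_eq => i [x s] /=; rewrite /cyl_fun /=.
by congr (f _ (_, _)); apply: omorphism_eq.
Qed.

Lemma mapG_sop_comp i j k (t : 'Delta(j, k)) (s : 'Delta(i, j))
  (f : gmap (cyl X k) Y) :
  mapG_sop (t \o s : 'Delta(i, k)) f = mapG_sop s (mapG_sop t f).
Proof.
apply: gmap_eq => l [x r] /=; rewrite /cyl_fun /=.
by congr (f _ (_, _)); apply: omorphism_eq.
Qed.

Definition mapG : sset := SSet mapG_sop_id mapG_sop_comp.
End Obj.

Section Map.
Variables (X X' Y Y' : gsset G) (u : gmap X' X) (v : gmap Y Y').

Definition mapG_fun k (f : mapG X Y k) : mapG X' Y' k :=
  gmap_comp v (gmap_comp f (cyl_map u idfun)).

Lemma mapG_fun_sop j k (t : 'Delta(j, k)) (f : mapG X Y k) :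
  mapG_fun (sop t f) = sop t (mapG_fun f).
Proof.
apply: gmap_eq => l [x r] /=; rewrite /cyl_fun /=.
by congr (v _ (f _ (_, _))); apply: omorphism_eq.
Qed.

Definition mapG_map : smap (mapG X Y) (mapG X' Y') := SMap mapG_fun_sop.
End Map.

End MapG.

(** A totally disconnected groupoid with set of objects [nat] is the family of
    its vertex groups [vgrp n], with product the composition.  The monoidal
    structure has identity associators; its unit object is necessarily [1], and
    [lunit n], [runit n] are the unit isomorphisms [1 * n -> n], [n * 1 -> n],
    viewed as automorphisms of [n] and allowed to be nontrivial. *)
Record mgroupoid := MGroupoid {
  vgrp :> nat -> groupType;
  nu : forall m n, UMagmaMorphism.type (vgrp m * vgrp n)%type (vgrp (m * n)%N);
  nuA : forall l m n (a : vgrp l) (b : vgrp m) (c : vgrp n),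
    ecast k (vgrp k) (esym (mulnA l m n)) (nu (l * m)%N n (nu l m (a, b), c))
      = nu l (m * n)%N (a, nu m n (b, c));
  lunit : forall n, vgrp n;
  runit : forall n, vgrp n;
  lunit_nat : forall n (a : vgrp n),
    lunit n * ecast k (vgrp k) (mul1n n) (nu 1 n (1, a)) = a * lunit n;
  runit_nat : forall n (a : vgrp n),
    runit n * ecast k (vgrp k) (muln1 n) (nu n 1 (a, 1)) = a * runit n;
  unit_triangle : forall m n, nu m n (runit m, 1) = nu m n (1, lunit n) }.

Arguments nu {_} m n.

Section PairIncl.
Variables G H : groupType.

Definition pair_inl (a : G) : (G * H)%type := (a, 1).
Definition pair_inr (b : H) : (G * H)%type := (1, b).

Lemma pair_inl_morphism : monoid_morphism pair_inl.
Proof. by split=> // a b; rewrite /pair_inl; congr pair; rewrite ?mulg1. Qed.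
Lemma pair_inr_morphism : monoid_morphism pair_inr.
Proof. by split=> // a b; rewrite /pair_inr; congr pair; rewrite ?mulg1. Qed.

HB.instance Definition _ := isUMagmaMorphism.Build G (G * H)%type pair_inl pair_inl_morphism.
HB.instance Definition _ := isUMagmaMorphism.Build H (G * H)%type pair_inr pair_inr_morphism.
End PairIncl.

Section GSeq.
Variable G : mgroupoid.

(** As [G] is totally disconnected, a contravariant functor from [G] to
    simplicial sets is a family of simplicial sets with right actions of the
    vertex groups, and a natural transformation is a family of equivariant maps. *)
Definition gseq := forall n, gsset (G n).
Definition gseq_hom (X Y : gseq) := forall n, gmap (X n) (Y n).
Definition gseq_id (X : gseq) : gseq_hom X X := fun n => gmap_id (X n).
Definition gseq_comp (X Y Z : gseq) (f : gseq_hom Y Z) (g : gseq_hom X Y) :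
  gseq_hom X Z := fun n => gmap_comp (f n) (g n).

Lemma gseq_eq (X Y : gseq) (f g : gseq_hom X Y) :
  (forall n k (x : X n k), f n k x = g n k x) -> f = g.
Proof.
by move=> fg; apply/functional_extensionality_dep => n; apply: gmap_eq.
Qed.

Lemma gseq_comp1 (X Y : gseq) (f : gseq_hom X Y) : gseq_comp (@gseq_id Y) f = f.
Proof. exact: gseq_eq. Qed.

Lemma gseq_1comp (X Y : gseq) (f : gseq_hom X Y) : gseq_comp f (@gseq_id X) = f.
Proof. exact: gseq_eq. Qed.

Lemma gseq_compA (W X Y Z : gseq) (f : gseq_hom Y Z) (g : gseq_hom X Y)
  (h : gseq_hom W X) :
  gseq_comp f (gseq_comp g h) = gseq_comp (gseq_comp f g) h.
Proof. exact: gseq_eq. Qed.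

Definition GSeq : category := Category gseq_comp1 gseq_1comp gseq_compA.

Record factorization (n : nat) := Factorization {
  lfactor : nat;
  rfactor : nat;
  factorizationE : (lfactor * rfactor = n)%N }.

Definition nu_at n (p : factorization n) :
  UMagmaMorphism.type (G (lfactor p) * G (rfactor p))%type (G n) :=
  ecast k (UMagmaMorphism.type (G (lfactor p) * G (rfactor p))%type (G k))
    (factorizationE p) (nu (lfactor p) (rfactor p)).

Definition square (X Y : GSeq) : GSeq := fun n =>
  coprod (fun p : factorization n =>
    induced (nu_at p) (extprod (X (lfactor p)) (Y (rfactor p)))).

Definition square_map (X X' Y Y' : GSeq) (u : hom X X') (v : hom Y Y') :
  hom (square X Y) (square X' Y') := fun n =>
  coprod_map (fun p : factorization n =>
    induced_map (nu_at p) (extprod_map (u (lfactor p)) (v (rfactor p)))).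

Lemma square_map_id (X Y : GSeq) :
  square_map (idm X) (idm Y) = idm (square X Y).
Proof.
apply: gseq_eq => n k [p x] /=; rewrite /coprod_fun /=; congr existT.
by have [[[y z] g] ->] := qclassP x; rewrite induced_funE.
Qed.

Lemma square_map_comp (X X' X'' Y Y' Y'' : GSeq) (u' : hom X' X'') (u : hom X X')
  (v' : hom Y' Y'') (v : hom Y Y') :
  square_map (compm u' u) (compm v' v)
    = compm (square_map u' v') (square_map u v).
Proof.
apply: gseq_eq => n k [p x] /=; rewrite /coprod_fun /=; congr existT.
by have [[[y z] g] ->] := qclassP x; rewrite !induced_funE.
Qed.

Lemma squarer_comp (Y X X' X'' : GSeq) (u' : hom X' X'') (u : hom X X') :
  square_map (compm u' u) (idm Y)
    = compm (square_map u' (idm Y)) (square_map u (idm Y)).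
Proof. by rewrite -square_map_comp comp1m. Qed.

Definition squarer (Y : GSeq) : functor GSeq GSeq :=
  Functor (square_map_id ^~ Y) (@squarer_comp Y).

Section MapSeq.

Section Obj.
Variables X Y : GSeq.

Definition mapseq_sop j k (t : 'Delta(j, k)) (f : forall n, mapG (X n) (Y n) k)
  (n : nat) : mapG (X n) (Y n) j := sop t (f n).

Lemma mapseq_sop_id k (f : forall n, mapG (X n) (Y n) k) :
  mapseq_sop (idfun : 'Delta(k, k)) f = f.
Proof. by apply/functional_extensionality_dep => n; apply: sop_id. Qed.

Lemma mapseq_sop_comp i j k (t : 'Delta(j, k)) (s : 'Delta(i, j))
  (f : forall n, mapG (X n) (Y n) k) :
  mapseq_sop (t \o s : 'Delta(i, k)) f = mapseq_sop s (mapseq_sop t f).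
Proof. by apply/functional_extensionality_dep => n; apply: sop_comp. Qed.

Definition mapseq : sset := SSet mapseq_sop_id mapseq_sop_comp.
End Obj.

Section Map.
Variables (X X' Y Y' : GSeq) (u : hom X' X) (v : hom Y Y').

Definition mapseq_fun k (f : mapseq X Y k) : mapseq X' Y' k :=
  fun n => mapG_map (u n) (v n) k (f n).

Lemma mapseq_fun_sop j k (t : 'Delta(j, k)) (f : mapseq X Y k) :
  mapseq_fun (sop t f) = sop t (mapseq_fun f).
Proof. by apply/functional_extensionality_dep => n; apply: mapG_fun_sop. Qed.

Definition mapseq_map : smap (mapseq X Y) (mapseq X' Y') := SMap mapseq_fun_sop.
End Map.

Lemma mapseq_eq (X Y : GSeq) k (f g : mapseq X Y k) :
  (forall n l (x : cyl (X n) k l), (f n : gmap _ _) l x = (g n : gmap _ _) l x) ->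
  f = g.
Proof.
by move=> fg; apply/functional_extensionality_dep => n; apply: gmap_eq.
Qed.

Lemma mapseq_map_id (X Y : GSeq) k (f : mapseq X Y k) :
  mapseq_map (idm X) (idm Y) k f = f.
Proof.
apply: mapseq_eq => n l [x s] /=; rewrite /cyl_fun /=.
apply: (congr1 (fun r => (f n : gmap (cyl (X n) k) (Y n)) l (x, r))).
exact: omorphism_eq.
Qed.

Lemma mapseq_map_comp (X X' X'' Y Y' Y'' : GSeq) (u : hom X' X) (u' : hom X'' X')
  (v' : hom Y' Y'') (v : hom Y Y') k (f : mapseq X Y k) :
  mapseq_map (compm u u') (compm v' v) k f
    = mapseq_map u' v' k (mapseq_map u v k f).
Proof.
apply: mapseq_eq => n l [x s] /=; rewrite /cyl_fun /=.
congr (v' _ _ (v _ _ _)).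
apply: (congr1 (fun r => (f n : gmap (cyl (X n) k) (Y n)) l (_, r))).
exact: omorphism_eq.
Qed.

End MapSeq.

(** [gamma n X] is the sequence [m |-> X (n * m)], where [G m] acts through
    [a |-> nu n m (1, a)]; the commuting action of [G n], [gamma_act], is through
    [b |-> nu n m (b, 1)].  Here [n] comes first because [square] pairs
    [X n] with [Y m] by means of [nu n m], so that maps from [square X Y] to [Z]
    are families of maps [X n * Y m -> Z (n * m)] equivariant along [nu n m].
    With [X (m * n)] and [nu m n] instead, [mapgamma Y] below would be right
    adjoint to [X |-> square Y X], and in general not to [squarer Y]. *)

Definition gamma (n : nat) (X : GSeq) : GSeq := fun m =>
  gpull (@pair_inr (G n) (G m)) (gpull (nu n m) (X (n * m)%N)).

Definition gamma_map (n : nat) (X Y : GSeq) (u : hom X Y) :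
  hom (gamma n X) (gamma n Y) := fun m =>
  gpull_map (@pair_inr (G n) (G m)) (gpull_map (nu n m) (u (n * m)%N)).

Lemma gamma_map_id n (X : GSeq) : gamma_map n (idm X) = idm (gamma n X).
Proof. exact: gseq_eq. Qed.

Lemma gamma_map_comp n (X Y Z : GSeq) (v : hom Y Z) (u : hom X Y) :
  gamma_map n (compm v u) = compm (gamma_map n v) (gamma_map n u).
Proof. exact: gseq_eq. Qed.

Section GammaAct.
Variables (n : nat) (X : GSeq) (b : G n).

Definition gamma_act_fun m k (x : gamma n X m k) : gamma n X m k :=
  @gact _ (gpull (@pair_inl (G n) (G m)) (gpull (nu n m) (X (n * m)%N))) k x b.

Lemma gamma_act_sop m j k (t : 'Delta(j, k)) (x : gamma n X m k) :
  gamma_act_fun (sop t x) = sop t (gamma_act_fun x).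
Proof. exact: (gact_sop (g := X (n * m)%N)). Qed.

Lemma gamma_act_gact m k (x : gamma n X m k) a :
  SMap (@gamma_act_sop m) k (gact x a) = gact (SMap (@gamma_act_sop m) k x) a.
Proof.
rewrite /gamma_act_fun /= -!gactM -!gmulfM.
by congr (gact _ (nu _ _ _)); congr pair; rewrite /= ?mulg1 ?mul1g.
Qed.

Definition gamma_act : hom (gamma n X) (gamma n X) :=
  fun m => GMap (@gamma_act_gact m).
End GammaAct.

Lemma gamma_act1 n (X : GSeq) : gamma_act X (1 : G n) = idm (gamma n X).
Proof.
apply: gseq_eq => m k x.
exact: (@gact1 _ (gpull (@pair_inl (G n) (G m))
  (gpull (nu n m) (X (n * m)%N))) k x).
Qed.

Lemma gamma_actM n (X : GSeq) (a b : G n) :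
  gamma_act X (a * b) = compm (gamma_act X b) (gamma_act X a).
Proof.
apply: gseq_eq => m k x.
exact: (@gactM _ (gpull (@pair_inl (G n) (G m))
  (gpull (nu n m) (X (n * m)%N))) k x a b).
Qed.

Lemma gamma_act_map n (X Y : GSeq) (u : hom X Y) (b : G n) :
  compm (gamma_map n u) (gamma_act X b) = compm (gamma_act Y b) (gamma_map n u).
Proof. by apply: gseq_eq => m k x /=; apply: gmap_gact. Qed.

Section MapGamma.

Section Obj.
Variables (Y Z : GSeq) (n : nat).

Definition mapgamma_act k (f : mapseq Y (gamma n Z) k) (b : G n) :
  mapseq Y (gamma n Z) k := mapseq_map (idm Y) (gamma_act Z b) k f.

Lemma mapgamma_act1 k (f : mapseq Y (gamma n Z) k) : mapgamma_act f 1 = f.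
Proof. by rewrite /mapgamma_act gamma_act1 mapseq_map_id. Qed.

Lemma mapgamma_actM k (f : mapseq Y (gamma n Z) k) a b :
  mapgamma_act f (a * b) = mapgamma_act (mapgamma_act f a) b.
Proof. by rewrite /mapgamma_act gamma_actM -mapseq_map_comp comp1m. Qed.

Lemma mapgamma_act_sop j k (t : 'Delta(j, k)) (f : mapseq Y (gamma n Z) k) b :
  mapgamma_act (sop t f) b = sop t (mapgamma_act f b).
Proof. exact: smap_sop. Qed.

End Obj.

Definition mapgamma (Y Z : GSeq) : GSeq := fun n =>
  GSSet (@mapgamma_act1 Y Z n) (@mapgamma_actM Y Z n) (@mapgamma_act_sop Y Z n).

Lemma mapgamma_map_gact (Y Y' Z Z' : GSeq) (u : hom Y' Y) (v : hom Z Z') n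
  k (f : mapgamma Y Z n k) (b : G n) :
  mapseq_map u (gamma_map n v) k (gact f b)
    = gact (mapseq_map u (gamma_map n v) k f : mapgamma Y' Z' n k) b.
Proof.
transitivity (mapseq_map (compm (idm Y) u)
    (compm (gamma_map n v) (gamma_act Z b)) k f).
  by rewrite mapseq_map_comp.
by rewrite gamma_act_map comp1m -[u in LHS]compm1 mapseq_map_comp.
Qed.

Definition mapgamma_map (Y Y' Z Z' : GSeq) (u : hom Y' Y) (v : hom Z Z') :
  hom (mapgamma Y Z) (mapgamma Y' Z') := fun n =>
  @GMap _ (mapgamma Y Z n) (mapgamma Y' Z' n) (mapseq_map u (gamma_map n v))
    (@mapgamma_map_gact Y Y' Z Z' u v n).

Lemma mapgamma_map_id (Y Z : GSeq) :
  mapgamma_map (idm Y) (idm Z) = idm (mapgamma Y Z).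
Proof.
by apply: gseq_eq => n k f /=; rewrite gamma_map_id; apply: mapseq_map_id.
Qed.

Lemma mapgamma_map_comp (Y Y' Y'' Z Z' Z'' : GSeq) (u : hom Y' Y) (u' : hom Y'' Y')
  (v' : hom Z' Z'') (v : hom Z Z') :
  mapgamma_map (compm u u') (compm v' v)
    = compm (mapgamma_map u' v') (mapgamma_map u v).
Proof.
by apply: gseq_eq => n k f /=; rewrite gamma_map_comp; apply: mapseq_map_comp.
Qed.

Lemma mapgamma_compr (Y Z Z' Z'' : GSeq) (v' : hom Z' Z'') (v : hom Z Z') :
  mapgamma_map (idm Y) (compm v' v)
    = compm (mapgamma_map (idm Y) v') (mapgamma_map (idm Y) v).
Proof. by rewrite -mapgamma_map_comp comp1m. Qed.

Definition mapgamma_functor (Y : GSeq) : functor GSeq GSeq :=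
  Functor (mapgamma_map_id Y) (@mapgamma_compr Y).

End MapGamma.

End GSeq.

(* Main.v *)
(** Maps [square X Y -> Z] and maps [X -> mapgamma Y Z] both amount to families
    [phi] of maps [X n * Y m -> Z (n * m)] equivariant along [nu n m]: the former
    by the universal properties of coproducts and of balanced products, the
    latter by currying.  A [k]-simplex [x] of [X n] is sent to the map
    [(y, s) |-> phi (sop s x) y] on [Y m * Delta^k], and [phi x y] is recovered
    as its value at [(y, id)]. *)
Require Import Defs.
From mathcomp Require Import all_boot all_order.
From mathcomp Require Import boolp classical_sets.
Set Implicit Arguments.
Unset Strict Implicit.
Unset Printing Implicit Defensive.

Local Open Scope group_scope.

(** * Maps out of quotients, balanced products and coproducts *)

Section QuotientLift.
Variables (T W : Type) (R : T -> set T) (w : T -> W).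
Hypothesis R_refl : forall x, R x x.
Hypothesis wR : forall x y, R x y -> w x = w y.

(** The value is taken at a representative picked by choice; [quot_liftE] shows that the pick does
    not matter when [w] respects [R]. *)
Definition quot_lift (p : quot R) : W := w (sval (cid (qclassP p))).

Lemma quot_liftE x : quot_lift (qclass R x) = w x.
Proof.
(* Equal classes are equal sets [R x = R y], so reflexivity at [x] puts [x] in [R y]. *)
rewrite /quot_lift; case: cid => y /= /(congr1 sval) /= xy.
by apply: wR; rewrite -xy; apply: R_refl.
Qed.

End QuotientLift.

Section InducedAdjunction.
Variables (H G : groupType) (f : UMagmaMorphism.type H G).

Lemma induced_gactE (X : gsset H) k (x : X k) g a :
  gact (qclass _ (x, g) : induced f X k) a = qclass _ (x, g * a).
Proof. exact: induced_actE. Qed.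

Section Unit.
Variable X : gsset H.

Definition induced_unit_fun k (x : X k) : gpull f (induced f X) k :=
  qclass _ (x, 1).

Lemma induced_unit_sop j k (t : 'Delta(j, k)) (x : X k) :
  induced_unit_fun (sop t x) = sop t (induced_unit_fun x).
Proof. by rewrite /induced_unit_fun [RHS]induced_sopE. Qed.

(** This is the defining identification of [(x, f h * g)] with [(gact x h, g)] at [g = 1]. *)
Lemma induced_unit_gact k (x : X k) h :
  SMap induced_unit_sop k (gact x h) = gact (SMap induced_unit_sop k x) h.
Proof.
rewrite [RHS]induced_actE mul1g; apply: quot_eq.
by rewrite /= -balancedP mulg1.
Qed.

Definition induced_unit : gmap X (gpull f (induced f X)) :=
  GMap induced_unit_gact.

End Unit.

Section Lift.
Variables (X : gsset H) (Z : gsset G) (u : gmap X (gpull f Z)).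

Lemma induced_lift_balanced k (p q : X k * G) : balanced f p q ->
  gact (u k p.1 : Z k) p.2 = gact (u k q.1 : Z k) q.2.
Proof.
by case: p q => [x g] [y c] [h /= [-> ->]]; rewrite gmap_gact gactM.
Qed.

Definition induced_lift_fun k : induced f X k -> Z k :=
  quot_lift (fun p : X k * G => gact (u k p.1 : Z k) p.2).

Lemma induced_lift_funE k (x : X k) g :
  induced_lift_fun (qclass _ (x, g)) = gact (u k x : Z k) g.
Proof. exact: (quot_liftE (@balanced_refl _ _ f X k) (@induced_lift_balanced k)). Qed.

Lemma induced_lift_sop j k (t : 'Delta(j, k)) (p : induced f X k) :
  induced_lift_fun (sop t p) = sop t (induced_lift_fun p).
Proof.
have [[x g] ->] := qclassP p.
rewrite [sop t _]induced_sopE !induced_lift_funE smap_sop.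
exact: (gact_sop (g := Z)).
Qed.

Lemma induced_lift_gact k (p : induced f X k) a :
  SMap induced_lift_sop k (gact p a) = gact (SMap induced_lift_sop k p) a.
Proof.
have [[x g] ->] := qclassP p.
by rewrite induced_gactE /= !induced_lift_funE gactM.
Qed.

Definition induced_lift : gmap (induced f X) Z := GMap induced_lift_gact.

End Lift.

Lemma induced_liftE (X : gsset H) (Z : gsset G) (u : gmap X (gpull f Z)) k
  (x : X k) : induced_lift u k (induced_unit X k x) = u k x.
Proof. by rewrite [LHS]induced_lift_funE gact1. Qed.

Lemma induced_map_unit (X Y : gsset H) (u : gmap X Y) k (x : X k) :
  induced_map f u k (induced_unit X k x) = induced_unit Y k (u k x).
Proof. exact: induced_funE. Qed.

End InducedAdjunction.

Section CoproductLift.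
Variables (G : groupType) (I : Type) (X : I -> gsset G) (Z : gsset G).
Variable u : forall i, gmap (X i) Z.

Definition coprod_lift_fun k (p : coprod X k) : Z k := u (tag p) k (tagged p).

Lemma coprod_lift_sop j k (t : 'Delta(j, k)) (p : coprod X k) :
  coprod_lift_fun (sop t p) = sop t (coprod_lift_fun p).
Proof. exact: smap_sop. Qed.

Lemma coprod_lift_gact k (p : coprod X k) a :
  SMap coprod_lift_sop k (gact p a) = gact (SMap coprod_lift_sop k p) a.
Proof. exact: gmap_gact. Qed.

Definition coprod_lift : gmap (coprod X) Z := GMap coprod_lift_gact.

End CoproductLift.

(** * Maps out of the matrix product as families of equivariant maps *)

Section Bimorphisms.
Variable G : mgroupoid.

Definition bihom (X Y Z : GSeq G) := forall n m,
  gmap (extprod (X n) (Y m)) (gpull (nu n m) (Z (n * m)%N)).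

Section Square.
Variables X Y : GSeq G.

(** At [Factorization erefl] the cast in [nu_at] reduces to [nu n m], so this summand is induced
    along [nu n m] itself and no transport appears. *)
Definition square_in n m k (x : X n k) (y : Y m k) : square X Y (n * m)%N k :=
  existT (fun p : factorization (n * m) =>
      induced (nu_at G p) (extprod (X (lfactor p)) (Y (rfactor p))) k)
    (Factorization erefl) (induced_unit (nu n m) (extprod (X n) (Y m)) k (x, y)).

Lemma square_in_sop n m j k (t : 'Delta(j, k)) (x : X n k) (y : Y m k) :
  square_in (sop t x) (sop t y) = sop t (square_in x y).
Proof.
by congr existT; apply: (smap_sop (induced_unit (nu n m) (extprod (X n) (Y m))) t (x, y)).
Qed.

Lemma square_in_gact n m k (x : X n k) (y : Y m k) a b :
  square_in (gact x a) (gact y b) = gact (square_in x y) (nu n m (a, b)).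
Proof.
congr existT.
exact: (gmap_gact (induced_unit (nu n m) (extprod (X n) (Y m))) (x, y) (a, b)).
Qed.

(** Matching on the equation [E] turns [n] into [l * m], where [phi l m] applies; on [square_in] the
    match reduces by computation. *)
Definition square_lift_at (Z : GSeq G) (phi : bihom X Y Z) n
  (p : factorization n) :
  gmap (induced (nu_at G p) (extprod (X (lfactor p)) (Y (rfactor p)))) (Z n) :=
  let: Factorization l m E := p return
    gmap (induced (nu_at G p) (extprod (X (lfactor p)) (Y (rfactor p)))) (Z n) in
  match E as E' in _ = n' return
    gmap (induced (nu_at G (Factorization E')) (extprod (X l) (Y m))) (Z n')
  with erefl => induced_lift (phi l m) end.

Definition square_lift (Z : GSeq G) (phi : bihom X Y Z) : hom (square X Y) Z :=
  fun n => coprod_lift (square_lift_at phi (n := n)).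

Lemma square_liftE (Z : GSeq G) (phi : bihom X Y Z) n m k (x : X n k) (y : Y m k) :
  square_lift phi (n * m)%N k (square_in x y) = phi n m k (x, y).
Proof. exact: induced_liftE. Qed.

(** The simplices [square_in x y] generate: every simplex of the product is a translate of one of
    them under the group action. *)
Lemma square_ext (Z : GSeq G) (f g : hom (square X Y) Z) :
  (forall n m k (x : X n k) (y : Y m k),
    f (n * m)%N k (square_in x y) = g (n * m)%N k (square_in x y)) ->
  f = g.
Proof.
move=> fg; apply: gseq_eq => n k [[l m E] q]; case: n / E q => q.
have [[[x y] a] ->] := qclassP q.
set s := existT _ _ _.
(* The class of [((x, y), a)] is the class of [((x, y), 1)] acted on by [a]. *)
have -> : s = gact (square_in x y) a.
  by rewrite /s; congr existT; rewrite /= [RHS]induced_actE mul1g.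
by rewrite !gmap_gact fg.
Qed.

End Square.

Lemma square_map_in (X X' Y Y' : GSeq G) (u : hom X X') (v : hom Y Y') n m k
  (x : X n k) (y : Y m k) :
  square_map u v (n * m)%N k (square_in x y) = square_in (u n k x) (v m k y).
Proof.
congr existT.
exact: (induced_map_unit (nu n m) (extprod_map (u n) (v m)) (x, y)).
Qed.

Lemma mapgamma_eq (X Y Z : GSeq G) (f g : hom X (mapgamma Y Z)) :
  (forall n k (x : X n k) m l (y : Y m l) (s : std_simplex k l),
    (f n k x m : gmap _ _) l (y, s) = (g n k x m : gmap _ _) l (y, s)) ->
  f = g.
Proof.
move=> fg; apply: gseq_eq => n k x; apply: mapseq_eq => m l [y s].
exact: fg.
Qed.

(** * Currying and uncurrying *)

Section Transpose.
Variables X Y Z : GSeq G.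

Section Curry.
Variable f : hom (square X Y) Z.

Section Simplex.
Variables (n k : nat) (x : X n k) (m : nat).

Definition curry_fun l (p : cyl (Y m) k l) : gamma n Z m l :=
  f (n * m)%N l (square_in (sop (p.2 : 'Delta(l, k)) x) p.1).

Lemma curry_fun_sop i j (t : 'Delta(i, j)) (p : cyl (Y m) k j) :
  curry_fun (sop t p) = sop t (curry_fun p).
Proof.
rewrite /curry_fun [in LHS]sop_comp square_in_sop.
exact: (smap_sop (f (n * m)%N)).
Qed.

Lemma curry_fun_gact l (p : cyl (Y m) k l) b :
  SMap curry_fun_sop l (gact p b) = gact (SMap curry_fun_sop l p) b.
Proof.
(* Letting [1] act on the first factor exhibits [b] as [nu n m (1, b)], the action that defines
   [gamma]. *)
rewrite /= /curry_fun /= -[in LHS](gact1 (sop _ x)) square_in_gact.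
exact: (gmap_gact (f (n * m)%N)).
Qed.

Definition curry_simplex : mapG (Y m) (gamma n Z m) k := GMap curry_fun_gact.

End Simplex.

Lemma curry_sop n j k (t : 'Delta(j, k)) (x : X n k) :
  (curry_simplex (sop t x) : mapgamma Y Z n j)
    = sop t (curry_simplex x : mapgamma Y Z n k).
Proof.
apply: mapseq_eq => m l [y s] /=.
by rewrite /curry_fun /= sop_comp.
Qed.

Lemma curry_gact n k (x : X n k) a :
  SMap (@curry_sop n) k (gact x a) = gact (SMap (@curry_sop n) k x) a.
Proof.
apply: mapseq_eq => m l [y s] /=.
(* Dually, [1] acts on [y], so that [a] becomes [nu n m (a, 1)], the commuting action
   [gamma_act]. *)
rewrite /curry_fun /= -(gact_sop s x a) -[in LHS](gact1 y) square_in_gact.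
rewrite gmap_gact; congr (gact (f _ _ (square_in (sop _ x) _)) _).
exact: omorphism_eq.
Qed.

Definition curry : hom X (mapgamma Y Z) := fun n => GMap (@curry_gact n).

End Curry.

Section Uncurry.
Variable g : hom X (mapgamma Y Z).

Section Component.
Variables n m : nat.

Definition uncurry_fun k (p : extprod (X n) (Y m) k) :
  gpull (nu n m) (Z (n * m)%N) k :=
  (g n k p.1 m : gmap _ _) k (p.2, idfun : 'Delta(k, k)).

(** As [g] is simplicial, applying [t] to [x] precomposes [g n k x] with [t] on the standard
    simplex, which sends the identity to [t]. Values at identities thus determine [g], whence
    [uncurryK]. *)
Lemma uncurry_sopl j k (t : 'Delta(j, k)) (x : X n k) (y : Y m j) :
  uncurry_fun (sop t x, y) = (g n k x m : gmap _ _) j (y, t).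
Proof.
rewrite /uncurry_fun /= smap_sop /=.
apply: (congr1 (fun r => (g n k x m : gmap (cyl (Y m) k) (gamma n Z m)) j (y, r))).
exact: omorphism_eq.
Qed.

Lemma uncurry_fun_sop j k (t : 'Delta(j, k)) (p : extprod (X n) (Y m) k) :
  uncurry_fun (sop t p) = sop t (uncurry_fun p).
Proof.
case: p => x y; rewrite [LHS]uncurry_sopl.
rewrite -[RHS](smap_sop (g n k x m : gmap _ _)) /=.
apply: (congr1 (fun r => (g n k x m : gmap (cyl (Y m) k) (gamma n Z m)) j (_, r))).
exact: omorphism_eq.
Qed.

Lemma uncurry_fun_gact k (p : extprod (X n) (Y m) k) c :
  SMap uncurry_fun_sop k (gact p c) = gact (SMap uncurry_fun_sop k p) c.
Proof.
case: p c => x y [a b]; rewrite /= /uncurry_fun /= gmap_gact /=.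
set h := (g n k x m : gmap (cyl (Y m) k) (gamma n Z m)).
(* The pair [(a, b)] splits as [(1, b) * (a, 1)]: [b] comes out by equivariance of [h] in [y], and
   [a] by equivariance of [g] in [x]. *)
transitivity (gact (gact (h k (y, idfun : 'Delta(k, k)) : Z (n * m)%N k) (nu n m (1, b)))
    (nu n m (a, 1))).
  rewrite /gamma_act_fun /cyl_fun /=; congr gact.
  rewrite -[RHS](gmap_gact h).
  apply: (congr1 (fun r => h k (gact y b, r))).
  exact: omorphism_eq.
rewrite -gactM -gmulfM; congr (gact _ (nu _ _ _)).
by congr pair; rewrite /= ?mulg1 ?mul1g.
Qed.

Definition uncurry_at :
  gmap (extprod (X n) (Y m)) (gpull (nu n m) (Z (n * m)%N)) :=
  GMap uncurry_fun_gact.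

End Component.

Definition uncurry : hom (square X Y) Z := square_lift uncurry_at.

Lemma uncurryE n m k (x : X n k) (y : Y m k) :
  uncurry (n * m)%N k (square_in x y)
    = (g n k x m : gmap _ _) k (y, idfun : 'Delta(k, k)).
Proof. exact: square_liftE. Qed.

End Uncurry.

Lemma curryK : cancel curry uncurry.
Proof.
move=> f; apply: square_ext => n m k x y.
by rewrite uncurryE /= /curry_fun /= sop_id.
Qed.

Lemma uncurryK : cancel uncurry curry.
Proof.
move=> g; apply: mapgamma_eq => n k x m l y s.
by rewrite /= /curry_fun uncurryE; apply: uncurry_sopl.
Qed.

End Transpose.

(** * Naturality in all variables, and the adjunction *)

Lemma curry_natl (Y X X' Z : GSeq G) (u : hom X' X) (f : hom (square X Y) Z) :
  curry (compm f (square_map u (idm Y))) = compm (curry f) u.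
Proof.
apply: mapgamma_eq => n k x m l y s.
rewrite /= /curry_fun /= -(smap_sop (u n)).
by congr (f _ _ _); apply: square_map_in.
Qed.

Lemma curry_natr (Y X Z Z' : GSeq G) (v : hom Z Z') (f : hom (square X Y) Z) :
  curry (compm v f) = compm (mapgamma_map (idm Y) v) (curry f).
Proof.
apply: mapgamma_eq => n k x m l y s.
rewrite /= /curry_fun /=; congr (v _ _ (f _ _ (square_in (sop _ x) _))).
exact: omorphism_eq.
Qed.

(** Naturality in the parameter: both sides evaluate [f] at [x] paired with the image of [y] under
    [u]. *)
Lemma curry_natm (Y Y' X Z : GSeq G) (u : hom Y Y') (f : hom (square X Y') Z) :
  curry (compm f (square_map (idm X) u))
    = compm (mapgamma_map u (idm Z)) (curry f).
Proof.
apply: mapgamma_eq => n k x m l y s.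
rewrite /= /curry_fun /=; congr (f _ _ _).
rewrite [LHS]square_map_in; congr (square_in (sop _ x) _).
exact: omorphism_eq.
Qed.

Definition square_adjunction (Y : GSeq G) :
  adjunction (squarer Y) (mapgamma_functor Y) :=
  @Adjunction _ _ (squarer Y) (mapgamma_functor Y)
    (fun X Z => @curry X Y Z)
    (fun X Z => Bijective (@curryK X Y Z) (@uncurryK X Y Z))
    (@curry_natl Y) (@curry_natr Y).

End Bimorphisms.

Theorem proposition1p12 (G : mgroupoid) :
  exists adj : forall Y : GSeq G, adjunction (squarer Y) (mapgamma_functor Y),
    forall (Y Y' X Z : GSeq G) (u : hom Y Y') (f : hom (square X Y') Z),
      adj Y X Z (compm f (square_map (idm X) u))
        = compm (mapgamma_map u (idm Z)) (adj Y' X Z f).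
Proof.
exists (@square_adjunction G) => Y Y' X Z u f.
exact: curry_natm.
Qed.
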